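(* Let $G$ be a group acting faithfully by permutations on an infinite set $\Omega$, and suppose that $\Omega$ is equipped with a closure operator $\mathrm{cl}$ such that $(\Omega,\mathrm{cl})$ forms a $G$-invariant infinite-dimensional higher Neumann modular pregeometry. Let $r\ge 1$ and let $w=w(x_1,\dots,x_r)\in G*F_r$ be a regular word with constants in $G$. Then the set $$\{(g_1,\dots,g_r)\in G^r \mid w(g_1,\dots,g_r)\neq 1\}$$ is dense in $G^r$ with respect to the (product of the) topology of pointwise convergence on $G$ induced by the action on the discrete set $\Omega$. In particular, all mixed identities of $G$ are then singular.
   Context: Words. $F_r$ is the free group on generators $x_1,\dots,x_r$. A word with constants in $G$ in $r$ variables is an element $w$ of the free product $G*F_r$. For $(g_1,\dots,g_r)\in G^r$, $w(g_1,\dots,g_r)\in G$ is the image of $w$ under the homomorphism $G*F_r\to G$ which is the identity on $G$ and sends $x_i$ to $g_i$. The word $w$ is a mixed identity of $G$ if $w(g_1,\dots,g_r)=1$ for all $(g_1,\dots,g_r)\in G^r$. Let $\mathrm{rk}\colon G*F_r\to F_r$ be the homomorphism sending every element of $G$ to $1$ and fixing $F_r$ pointwise. The word $w$ is singular if $\mathrm{rk}(w)=1$, and regular otherwise. Pregeometries. A closure operator on $\Omega$ is a map $\mathrm{cl}\colon\mathcal P(\Omega)\to\mathcal P(\Omega)$ with $A\subseteq \mathrm{cl}(A)$, $\mathrm{cl}(\mathrm{cl}(A))=\mathrm{cl}(A)$, and $A\subseteq B\Rightarrow \mathrm{cl}(A)\subseteq\mathrm{cl}(B)$. $(\Omega,\mathrm{cl})$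 is a pregeometry if moreover $\mathrm{cl}$ has finite character ($\mathrm{cl}(A)$ is the union of $\mathrm{cl}(C)$ over finite $C\subseteq A$) and satisfies exchange: $a\in\mathrm{cl}(A\cup\{b\})\setminus\mathrm{cl}(A)$ implies $b\in\mathrm{cl}(A\cup\{a\})$. A set $A$ is closed if $\mathrm{cl}(A)=A$. It is independent if $b\notin\mathrm{cl}(A\setminus\{b\})$ for all $b\in A$. For $A\subseteq\Omega$, $\dim(A)$ is the common cardinality of all maximal independent subsets of $A$; $(\Omega,\mathrm{cl})$ is infinite-dimensional if $\dim(\Omega)$ is infinite. The pregeometry is modular if $\dim(A\cup B)+\dim(A\cap B)=\dim(A)+\dim(B)$ (cardinal addition) for all closed $A,B\subseteq\Omega$. It is $G$-invariant if $\mathrm{cl}(g\cdot C)=g\cdot\mathrm{cl}(C)$ for all $g\in G$, $C\subseteq\Omega$. Higher Neumann. For $A,B\subseteq\Omega$ write $A\perp B$ (''$A$ is independent from $B$'') if $\mathrm{cl}(A)\cap\mathrm{cl}(B)=\mathrm{cl}(\emptyset)$; for an element $a$, $a\perp B$ means $\{a\}\perp B$. For $B\subseteq \Omega$, $G_B$ is the pointwise stabiliser of $B$, and $a'\equiv_B a$ means $a'\in G_B\cdot a$. $(\Omega,\mathrm{cl})$ is higher Neumann if for all finite $B,C\subseteq\Omega$, all $a\in\Omega$ with $a\perp B$, and all finite $\Sigma\subseteq G$, there is $a'\equiv_B a$ such that $\Sigma\cdot a'\perp C$, where $\Sigma\cdot a'=\{\gamma(a')\mid\gamma\in\Sigma\}$.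 Topology. The topology of pointwise convergence on $G$ has as a basis the sets $\{h\in G\mid h(\bar b)=\bar b'\}$, where $\bar b,\bar b'$ are finite tuples of elements of $\Omega$ of the same length; $G^r$ carries the product topology. *)

(* Defs.v *)
From HB Require Import structures.
From mathcomp Require Import all_boot.
From mathcomp Require Import mathcomp_extra boolp classical_sets functions.
From mathcomp Require Import cardinality topology.

Set Implicit Arguments.
Unset Strict Implicit.
Unset Printing Implicit Defensive.

Local Open Scope classical_set_scope.
Local Open Scope group_scope.
Local Open Scope quotient_scope.
Local Open Scope card_scope.

(* Free groups and free products are built as groups <X | R>: formal group
   expressions over X modulo the smallest congruence containing R and the
   group laws. *)

Inductive gexpr (X : Type) : Type :=
| GOne
| GGen of X
| GInv of gexpr X
| GMul of gexpr X & gexpr X.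
Arguments GOne {X}.

Fixpoint gexpr_eval (X : Type) (H : groupType) (f : X -> H) (e : gexpr X) : H :=
  match e with
  | GOne => 1
  | GGen x => f x
  | GInv a => (gexpr_eval f a)^-1
  | GMul a b => gexpr_eval f a * gexpr_eval f b
  end.

Section Presentation.
Context {X : Type} (R : gexpr X -> gexpr X -> Prop).

Inductive gcong : gexpr X -> gexpr X -> Prop :=
| gcong_rel a b : R a b -> gcong a b
| gcong_refl a : gcong a a
| gcong_sym a b : gcong a b -> gcong b a
| gcong_trans a b c : gcong a b -> gcong b c -> gcong a c
| gcong_inv a b : gcong a b -> gcong (GInv a) (GInv b)
| gcong_mul a a' b b' :
    gcong a a' -> gcong b b' -> gcong (GMul a b) (GMul a' b')
| gcong_mulA a b c : gcong (GMul a (GMul b c)) (GMul (GMul a b) c)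
| gcong_mul1 a : gcong (GMul GOne a) a
| gcong_mulr1 a : gcong (GMul a GOne) a
| gcong_mulV a : gcong (GMul (GInv a) a) GOne
| gcong_mulrV a : gcong (GMul a (GInv a)) GOne.

HB.instance Definition _ := gen_eqMixin (gexpr X).
HB.instance Definition _ := gen_choiceMixin (gexpr X).

Definition gcongb (a b : gexpr X) : bool := `[< gcong a b >].

Lemma gcongb_refl : reflexive gcongb.
Proof. by move=> a; apply/asboolP; exact: gcong_refl. Qed.

Lemma gcongb_sym : symmetric gcongb.
Proof. by move=> a b; apply/asboolP/asboolP; exact: gcong_sym. Qed.

Lemma gcongb_trans : transitive gcongb.
Proof.
by move=> b a c /asboolP ab /asboolP bc; apply/asboolP; exact: gcong_trans bc.
Qed.

Canonical gcongb_equiv := EquivRel gcongb gcongb_refl gcongb_sym gcongb_trans.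

Definition presented : Type := {eq_quot gcongb}.
HB.instance Definition _ := Choice.on presented.

Definition presented_class (a : gexpr X) : presented := \pi_({eq_quot gcongb}) a.
Definition presented_repr (p : presented) : gexpr X :=
  repr (p : {eq_quot gcongb}).

Lemma presented_reprK : cancel presented_repr presented_class.
Proof. by move=> p; exact: reprK. Qed.

Lemma presented_classP a b :
  presented_class a = presented_class b <-> gcong a b.
Proof.
split=> [/eqmodP/asboolP //|ab]; apply/eqmodP; exact/asboolP.
Qed.

Lemma presented_classK a : gcong (presented_repr (presented_class a)) a.
Proof. by apply/presented_classP; rewrite presented_reprK. Qed.

Definition presented_one : presented := presented_class GOne.
Definition presented_inv (p : presented) : presented :=
  presented_class (GInv (presented_repr p)).
Definition presented_mul (p q : presented) : presented :=
  presented_class (GMul (presented_repr p) (presented_repr q)).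

Lemma presented_class_inv a :
  presented_inv (presented_class a) = presented_class (GInv a).
Proof. by apply/presented_classP/gcong_inv/presented_classK. Qed.

Lemma presented_class_mul a b :
  presented_mul (presented_class a) (presented_class b)
  = presented_class (GMul a b).
Proof. by apply/presented_classP/gcong_mul; exact: presented_classK. Qed.

Lemma presented_ind (P : presented -> Prop) :
  (forall a, P (presented_class a)) -> forall p, P p.
Proof. by move=> Pc p; rewrite -[p]presented_reprK. Qed.

Lemma presented_mulA : associative presented_mul.
Proof.
elim/presented_ind=> a; elim/presented_ind=> b; elim/presented_ind=> c.
by rewrite !presented_class_mul; apply/presented_classP/gcong_mulA.
Qed.

Lemma presented_mul1 : left_id presented_one presented_mul.
Proof.
elim/presented_ind=> a; rewrite presented_class_mul.
exact/presented_classP/gcong_mul1.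
Qed.

Lemma presented_mulr1 : right_id presented_one presented_mul.
Proof.
elim/presented_ind=> a; rewrite presented_class_mul.
exact/presented_classP/gcong_mulr1.
Qed.

Lemma presented_mulV : left_inverse presented_one presented_inv presented_mul.
Proof.
elim/presented_ind=> a; rewrite presented_class_inv presented_class_mul.
exact/presented_classP/gcong_mulV.
Qed.

Lemma presented_mulrV : right_inverse presented_one presented_inv presented_mul.
Proof.
elim/presented_ind=> a; rewrite presented_class_inv presented_class_mul.
exact/presented_classP/gcong_mulrV.
Qed.

HB.instance Definition _ := isGroup.Build presented
  presented_mulA presented_mul1 presented_mulr1 presented_mulV presented_mulrV.

Definition presented_gen (x : X) : presented := presented_class (GGen x).

Definition presented_lift (H : groupType) (f : X -> H) (p : presented) : H :=
  gexpr_eval f (presented_repr p).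

Definition respects (H : groupType) (f : X -> H) : Prop :=
  forall a b, R a b -> gexpr_eval f a = gexpr_eval f b.

Section Lift.
Context (H : groupType) (f : X -> H) (fR : respects f).

Lemma gcong_eval a b : gcong a b -> gexpr_eval f a = gexpr_eval f b.
Proof.
elim=> //=.
- by move=> {}a {}b c _ -> _ ->.
- by move=> {}a {}b _ ->.
- by move=> {}a a' {}b b' _ -> _ ->.
- by move=> *; rewrite mulgA.
- by move=> *; rewrite mul1g.
- by move=> *; rewrite mulg1.
- by move=> *; rewrite mulVg.
- by move=> *; rewrite mulgV.
Qed.

Lemma presented_lift_class a :
  presented_lift f (presented_class a) = gexpr_eval f a.
Proof. exact/gcong_eval/presented_classK. Qed.

Lemma presented_lift_morphism : monoid_morphism (presented_lift f).
Proof.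
split=> [|]; first exact: presented_lift_class.
elim/presented_ind=> a; elim/presented_ind=> b.
by rewrite [_ * _]presented_class_mul !presented_lift_class.
Qed.

End Lift.

Lemma presented_lift_unique (H : groupType)
    (h h' : UMagmaMorphism.type presented H) :
  (forall x, h (presented_gen x) = h' (presented_gen x)) -> h =1 h'.
Proof.
move=> hh'; elim/presented_ind; elim=> [|x|a IHa|a IHa b IHb].
- by rewrite -[presented_class _]/(1 : presented) !gmulf1.
- exact: hh'.
- rewrite -presented_class_inv -[presented_inv _]/((presented_class a : presented)^-1).
  by rewrite !gmulfV IHa.
- rewrite -presented_class_mul.
  rewrite -[presented_mul _ _]/((presented_class a : presented) * presented_class b).
  by rewrite !gmulfM IHa IHb.
Qed.

End Presentation.

Section FreeGroup.
Context (X : Type).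

Definition free_rel (_ _ : gexpr X) : Prop := False.

Definition free_group : Type := presented free_rel.
HB.instance Definition _ := Group.on free_group.

Definition free_gen (x : X) : free_group := presented_gen free_rel x.

Definition free_lift (H : groupType) (f : X -> H) : free_group -> H :=
  @presented_lift _ free_rel H f.

Lemma free_lift_morphism (H : groupType) (f : X -> H) :
  monoid_morphism (free_lift f).
Proof. by apply: presented_lift_morphism. Qed.

HB.instance Definition _ (H : groupType) (f : X -> H) :=
  isUMagmaMorphism.Build free_group H (free_lift f) (free_lift_morphism f).

Lemma free_lift_gen (H : groupType) (f : X -> H) x :
  free_lift f (free_gen x) = f x.
Proof. by rewrite /free_lift presented_lift_class. Qed.

Lemma free_lift_unique (H : groupType)
    (h h' : UMagmaMorphism.type free_group H) :
  (forall x, h (free_gen x) = h' (free_gen x)) -> h =1 h'.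
Proof. exact: presented_lift_unique. Qed.

End FreeGroup.

Section FreeProduct.
Context (A B : groupType).

Variant free_prod_rel : gexpr (A + B) -> gexpr (A + B) -> Prop :=
| FreeProdRelL (a a' : A) :
    free_prod_rel (GMul (GGen (inl a)) (GGen (inl a'))) (GGen (inl (a * a')))
| FreeProdRelR (b b' : B) :
    free_prod_rel (GMul (GGen (inr b)) (GGen (inr b'))) (GGen (inr (b * b'))).

Definition free_prod : Type := presented free_prod_rel.
HB.instance Definition _ := Group.on free_prod.

Definition free_prod_inl (a : A) : free_prod :=
  presented_gen free_prod_rel (inl a).
Definition free_prod_inr (b : B) : free_prod :=
  presented_gen free_prod_rel (inr b).

Lemma free_prod_inl_morphism : {morph free_prod_inl : a a' / a * a'}.
Proof.
move=> a a'; rewrite [RHS]presented_class_mul.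
apply/presented_classP/gcong_sym/gcong_rel; exact: FreeProdRelL.
Qed.

Lemma free_prod_inr_morphism : {morph free_prod_inr : b b' / b * b'}.
Proof.
move=> b b'; rewrite [RHS]presented_class_mul.
apply/presented_classP/gcong_sym/gcong_rel; exact: FreeProdRelR.
Qed.

Lemma morph_mul_one (H K : groupType) (f : H -> K) :
  {morph f : x y / x * y} -> f 1 = 1.
Proof. by move=> fM; apply: (mulgI (f 1)); rewrite -fM !mulg1. Qed.

HB.instance Definition _ := isUMagmaMorphism.Build A free_prod free_prod_inl
  (morph_mul_one free_prod_inl_morphism, free_prod_inl_morphism).
HB.instance Definition _ := isUMagmaMorphism.Build B free_prod free_prod_inr
  (morph_mul_one free_prod_inr_morphism, free_prod_inr_morphism).

Definition free_prod_lift (H : groupType) (f : A -> H) (g : B -> H) :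
    free_prod -> H :=
  @presented_lift _ free_prod_rel H
    (fun s => match s with inl a => f a | inr b => g b end).

Section Lift.
Context (H : groupType).
Context (f : UMagmaMorphism.type A H) (g : UMagmaMorphism.type B H).

Lemma free_prod_lift_respects :
  respects free_prod_rel
    (fun s : A + B => match s with inl a => f a | inr b => g b end).
Proof. by move=> _ _ [a a'|b b'] /=; rewrite gmulfM. Qed.

Lemma free_prod_lift_morphism : monoid_morphism (free_prod_lift f g).
Proof. exact/presented_lift_morphism/free_prod_lift_respects. Qed.

HB.instance Definition _ := isUMagmaMorphism.Build free_prod H
  (free_prod_lift f g) free_prod_lift_morphism.

Lemma free_prod_liftl a : free_prod_lift f g (free_prod_inl a) = f a.
Proof.
by rewrite /free_prod_lift presented_lift_class//; exact: free_prod_lift_respects.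
Qed.

Lemma free_prod_liftr b : free_prod_lift f g (free_prod_inr b) = g b.
Proof.
by rewrite /free_prod_lift presented_lift_class//; exact: free_prod_lift_respects.
Qed.

End Lift.

Lemma free_prod_lift_unique (H : groupType)
    (h h' : UMagmaMorphism.type free_prod H) :
  (forall a, h (free_prod_inl a) = h' (free_prod_inl a)) ->
  (forall b, h (free_prod_inr b) = h' (free_prod_inr b)) -> h =1 h'.
Proof. by move=> hl hr; apply: presented_lift_unique => -[]. Qed.

End FreeProduct.

Section Words.
Context (G : groupType) (r : nat).

Definition word : groupType := free_prod G (free_group 'I_r).

Definition word_eval (w : word) (g : 'I_r -> G) : G :=
  free_prod_lift (@idfun G) (free_lift g) w.

Definition mixed_identity (w : word) : Prop := forall g, word_eval w g = 1.

Definition rk (w : word) : free_group 'I_r :=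
  free_prod_lift (@one_fun G (free_group 'I_r)) (@idfun (free_group 'I_r)) w.

Lemma word_eval_morphism g : monoid_morphism (word_eval^~ g).
Proof. exact: free_prod_lift_morphism. Qed.

Lemma rk_morphism : monoid_morphism rk.
Proof. exact: free_prod_lift_morphism. Qed.

Definition singular (w : word) : Prop := rk w = 1.
Definition regular (w : word) : Prop := ~ singular w.

End Words.

Section Action.
Context (G : groupType) (Omega : Type).

Record group_action (act : G -> Omega -> Omega) : Prop := {
  act1 : forall x, act 1 x = x;
  actM : forall g h x, act (g * h) x = act g (act h x) }.

Definition faithful (act : G -> Omega -> Omega) : Prop :=
  forall g, (forall x, act g x = x) -> g = 1.

(* An alias of G, so that its topology can depend on the action. *)
Definition pointwise (act : G -> Omega -> Omega) : Type := G.

Context (act : G -> Omega -> Omega).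

HB.instance Definition _ := Group.on (pointwise act).

Definition pointwise_base : set (set (pointwise act)) :=
  [set U | exists (n : nat) (b b' : n.-tuple Omega),
      U = [set h | map (act h) b = b']].

Lemma pointwise_base_cover :
  \bigcup_(U in pointwise_base) (id U) = [set: pointwise act].
Proof.
rewrite -subTset => h _; exists setT => //.
by exists 0, [tuple], [tuple]; apply/seteqP; split.
Qed.

Lemma pointwise_base_join (U V : set (pointwise act)) t :
  pointwise_base U -> pointwise_base V -> (id U) t -> (id V) t ->
  exists W, [/\ pointwise_base W, (id W) t & id W `<=` id U `&` id V].
Proof.
move=> [m [b [b' ->]]] [n [c [c' ->]]] /= tb tc.
exists [set h | map (act h) (cat_tuple b c) = cat_tuple b' c']; split.
- by exists (m + n)%N, (cat_tuple b c), (cat_tuple b' c').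
- by rewrite /= map_cat tb tc.
- move=> h /=; rewrite map_cat => /(congr1 (fun s => (take m s, drop m s))).
  rewrite !take_size_cat ?drop_size_cat ?size_map ?size_tuple//.
  by case=> -> ->.
Qed.

HB.instance Definition _ := isBaseTopological.Build (pointwise act)
  pointwise_base_cover pointwise_base_join.

End Action.

Section Pregeometry.
Context (Omega : Type) (cl : set Omega -> set Omega).

Record closure_operator : Prop := {
  cl_sub : forall A, A `<=` cl A;
  cl_idem : forall A, cl (cl A) = cl A;
  cl_mono : forall A B, A `<=` B -> cl A `<=` cl B }.

Record pregeometry : Prop := {
  pregeometry_closure : closure_operator;
  cl_finite_character : forall A,
    cl A = \bigcup_(C in [set C | finite_set C /\ C `<=` A]) cl C;
  cl_exchange : forall A a b,
    (cl (A `|` [set b]) `\` cl A) a -> cl (A `|` [set a]) b }.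

Definition cl_closed (A : set Omega) : Prop := cl A = A.

Definition cl_independent (A : set Omega) : Prop :=
  forall b, A b -> ~ cl (A `\ b) b.

(* The maximal independent subsets of A. In a pregeometry they exist
   (cl_basis_exists) and all have the same cardinality, dim A; a condition on
   dim A is stated below as a condition on every such set. *)
Definition cl_basis (A X : set Omega) : Prop :=
  [/\ X `<=` A, cl_independent X &
      forall Y, Y `<=` A -> cl_independent Y -> X `<=` Y -> Y = X].

Definition infinite_dimensional : Prop :=
  forall X, cl_basis [set: Omega] X -> infinite_set X.

Definition disjoint_sum (X Y : set Omega) : set (Omega + Omega) :=
  inl @` X `|` inr @` Y.

Definition cl_modular : Prop :=
  forall A B, cl_closed A -> cl_closed B ->
  forall X Y U V, cl_basis (A `|` B) X -> cl_basis (A `&` B) Y ->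
    cl_basis A U -> cl_basis B V ->
    disjoint_sum X Y #= disjoint_sum U V.

Definition perp (A B : set Omega) : Prop := cl A `&` cl B = cl set0.

Lemma cl_basis_exists A : pregeometry -> exists X, cl_basis A X.
Proof.
move=> pg; have [clS _ clM] := pregeometry_closure pg.
have [|X [[XA Xi] Xmax]] :=
  @Zorn_bigcup Omega [set X | X `<=` A /\ cl_independent X].
  move=> F FP Ftot; split; first by apply: bigcup_sub => X /FP[].
  move=> b [X0 FX0 X0b]; rewrite (cl_finite_character pg) => -[C [Cfin CF] clCb].
  have [X [FX CX Xb]] : exists X, [/\ F X, C `<=` X & X b].
    have {}CF : C `<=` \bigcup_(X in F) X by move=> x /CF[].
    move: Cfin => /finite_setP[n]; elim: n C CF {clCb} => [|n IHn] C CF.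
      by rewrite II0 card_eq0 => /eqP ->; exists X0; split.
    move=> /eq_cardSP[x Cx CDx].
    have [|X [FX CX Xb]] := IHn (C `\ x) _ CDx; first by move=> y [/CF].
    have [Y FY Yx] := CF _ Cx.
    have [XY|YX] := Ftot _ _ FX FY.
    + exists Y; split=> //; last exact: XY.
      move=> y Cy; have [->//|yx] := pselect (y = x).
      by apply: XY; apply: CX; split.
    + exists X; split=> // y Cy; have [->|yx] := pselect (y = x).
        exact: YX.
      by apply: CX; split.
  have [_ Xi] := FP _ FX; apply: (Xi b Xb); apply: clM clCb => y Cy.
  by split; [exact: CX|move: (CF _ Cy) => -[]].
exists X; split=> // Y YA Yi XY; apply: contrapT => YX.
apply: (Xmax Y) => //; split=> // YX'; apply: YX; exact/seteqP.
Qed.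

End Pregeometry.

Section GroupPregeometry.
Context (G : groupType) (Omega : Type).
Context (act : G -> Omega -> Omega) (cl : set Omega -> set Omega).

Definition cl_invariant : Prop :=
  forall (g : G) (C : set Omega), cl (act g @` C) = act g @` cl C.

Definition pointwise_stabiliser (B : set Omega) : set G :=
  [set g | forall b, B b -> act g b = b].

Definition conj_over (B : set Omega) (a' a : Omega) : Prop :=
  exists2 g, pointwise_stabiliser B g & a' = act g a.

Definition higher_neumann : Prop :=
  forall (B C : set Omega) (a : Omega) (Sigma : set G),
    finite_set B -> finite_set C -> perp cl [set a] B -> finite_set Sigma ->
    exists2 a', conj_over B a' a &
      perp cl [set act s a' | s in Sigma] C.

End GroupPregeometry.

(* Main.v *)
(* Build the tuple u by finite approximation while following a point p through
   the letters of w, from right to left. The points met are organised into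
   levels indexed by F_r: finite sets L_v, jointly independent, with a constant
   keeping p in the closure of its level and x_i moving it from level v to level
   x_i v. When u_i p is forced by the partial map u_i built so far, independence
   of the levels shows that p already depends on the part of the domain of u_i in
   its own level, so u_i p lies in the closure of level x_i v; otherwise the
   higher Neumann property puts u_i p, with all its images under the relevant
   products of constants, independent from everything chosen before, and these
   images are added to level x_i v. The path starts outside cl(0) in level 1 and
   ends in the closure of level rk(w) <> 1, hence does not close up. *)

Require Import Defs.
From HB Require Import structures.
From mathcomp Require Import all_boot finmap.
From mathcomp Require Import mathcomp_extra boolp classical_sets functions.
From mathcomp Require Import cardinality topology.

Local Open Scope classical_set_scope.
Local Open Scope group_scope.
Local Open Scope card_scope.

Set Implicit Arguments.
Unset Strict Implicit.
Unset Printing Implicit Defensive.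

(** * Cardinality of finite sets *)

Lemma finite_subset_card_eq (T : Type) (A B : set T) :
  finite_set B -> A `<=` B -> A #= B -> A = B.
Proof.
move=> Bfin AB AeqB; have Afin := sub_finite_set AB Bfin.
apply: (@fset_set_inj {classic T}) => //.
have sAB : fsubset (@fset_set {classic T} A) (@fset_set {classic T} B).
  by rewrite -fset_set_sub.
by apply/fsetP/fsubset_cardP => //; exact/fcard_eq.
Qed.

Lemma finite_disjoint_sum (T : Type) (X Y : set T) :
  finite_set X -> finite_set Y -> finite_set (disjoint_sum X Y).
Proof. by move=> ? ?; rewrite finite_setU; split; exact: finite_image. Qed.

(** * Bases, modularity and independent families in a pregeometry *)

Section Pregeometry.
Context (Omega : Type) (cl : set Omega -> set Omega).
Hypothesis cl_pg : pregeometry cl.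

Let clS A : A `<=` cl A.
Proof. exact: (cl_sub (pregeometry_closure cl_pg)). Qed.

Let clI A : cl (cl A) = cl A.
Proof. exact: (cl_idem (pregeometry_closure cl_pg)). Qed.

Let clM A B : A `<=` B -> cl A `<=` cl B.
Proof. exact: (cl_mono (pregeometry_closure cl_pg)). Qed.

Lemma cl_subcl A B : A `<=` cl B -> cl A `<=` cl B.
Proof. by move=> AB; rewrite -[X in _ `<=` X]clI; exact: clM. Qed.

Lemma cl_set0_sub A : cl set0 `<=` cl A.
Proof. exact: clM. Qed.

(** By exchange: if some [x] in [X] depended on [a] and the rest of [X], then [a] would lie in
    [cl X]. *)
Lemma cl_independent_setU1 X a :
  cl_independent cl X -> ~ cl X a -> cl_independent cl (X `|` [set a]).
Proof.
move=> Xi Xa x [Xx|->] clx; last first.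
  by apply: Xa; apply: clM clx => y [[]].
have [ax|ax] := pselect (x = a); first by apply: Xa; rewrite -ax; exact: clS.
have XaE : (X `|` [set a]) `\ x `<=` (X `\ x) `|` [set a].
  by move=> y [[Xy|ya] yx]; [left|right].
have : cl ((X `\ x) `|` [set x]) a.
  by apply: (cl_exchange cl_pg); split; [exact: (clM XaE)|exact: Xi].
by move=> clXa; apply: Xa; apply: clM clXa => y [[]|->].
Qed.

Lemma cl_basis_span A X : cl_basis cl A X -> A `<=` cl X.
Proof.
move=> [XA Xi Xmax] a Aa; apply: contrapT => Xa.
have := Xmax (X `|` [set a]) _ (cl_independent_setU1 Xi Xa) _.
move=> XaX; apply/Xa/clS; rewrite -XaX; last 1 first.
- by left.
- by right.
- by move=> x [/XA|->].
Qed.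

Lemma independent_span_basis A X :
  X `<=` A -> cl_independent cl X -> A `<=` cl X -> cl_basis cl A X.
Proof.
move=> XA Xi AX; split=> // Y YA Yi XY; apply/seteqP; split=> // y Yy.
apply: contrapT => Xy; apply: (Yi y Yy); apply: clM (AX _ (YA _ Yy)) => x Xx.
by split; [exact: XY|move=> xy; apply: Xy; rewrite -xy].
Qed.

Lemma cl_basis_cl A X : cl_basis cl A X -> cl_basis cl (cl A) X.
Proof.
move=> bX; have [XA Xi _] := bX.
apply: independent_span_basis => //; first by move=> x /XA /clS.
by apply: cl_subcl; exact: cl_basis_span.
Qed.

Lemma cl_basis_set0 : cl_basis cl (cl set0) set0.
Proof. exact: independent_span_basis. Qed.

Hypothesis cl_mod : cl_modular cl.

(* Modularity enters only here: if p were not in cl D, then D and D + p would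
   give dim (D + X) two different values. *)
Lemma modular_elim (D X L : set Omega) p :
  finite_set D -> finite_set X -> D `<=` cl L ->
  cl X `&` cl L `<=` cl set0 -> cl L p -> cl (D `|` X) p -> cl D p.
Proof.
move=> Dfin Xfin DL XL Lp DXp; apply: contrapT => Dp.
have [U bU] := cl_basis_exists D cl_pg; have [UD Ui _] := bU.
have [V bV] := cl_basis_exists X cl_pg; have [VX Vi _] := bV.
have [Z bZ] := cl_basis_exists (cl D `|` cl X) cl_pg; have [ZDX Zi _] := bZ.
have Up : ~ cl U p.
  by move=> clUp; apply: Dp; apply: (clM UD).
pose U' := U `|` [set p]; pose D' := D `|` [set p].
have D'L : cl D' `<=` cl L by apply: cl_subcl => x [/DL|->].
have bU' : cl_basis cl D' U'.
  apply: independent_span_basis.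
  - by move=> x [/UD|->]; [left|right].
  - exact: cl_independent_setU1.
  - move=> x [Dx|->]; last by apply: clS; right.
    by apply: (@clM U) (cl_basis_span bU Dx) => y; left.
(* Since [p] lies in the closure of [D] and [X], adjoining it to [D] leaves [Z] a basis of the
   join. *)
have bZ' : cl_basis cl (cl D' `|` cl X) Z.
  apply: independent_span_basis => //.
  - move=> x /ZDX[Dx|]; last by right.
    by left; apply: clM Dx => y; left.
  - have DXZ : D `|` X `<=` cl Z.
      by move=> x [Dx|Xx]; apply: (cl_basis_span bZ); [left|right]; exact: clS.
    move=> x [|]; apply: cl_subcl => {}x; last by move=> Xx; apply: DXZ; right.
    move=> [Dx|->]; first by apply: DXZ; left.
    exact: (cl_subcl DXZ).
(* Both meets with [cl X] are trivial, with empty basis, so modularity compares only the joins. *)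
have cl0 E : cl E `<=` cl L -> cl E `&` cl X = cl set0.
  move=> EL; apply/seteqP; split=> [x [Ex Xx]|x x0].
    by apply: XL; split=> //; exact: EL.
  by split; exact: cl_set0_sub x0.
have eq1 : disjoint_sum Z set0 #= disjoint_sum U V.
  apply: (cl_mod (A := cl D) (B := cl X)) => //; try exact: clI.
  - by rewrite cl0; [exact: cl_basis_set0|exact: cl_subcl].
  - exact: cl_basis_cl.
  - exact: cl_basis_cl.
have eq2 : disjoint_sum Z set0 #= disjoint_sum U' V.
  apply: (cl_mod (A := cl D') (B := cl X)) => //; try exact: clI.
  - by rewrite cl0//; exact: cl_basis_set0.
  - exact: cl_basis_cl.
  - exact: cl_basis_cl.
(* A subset equinumerous with a finite set is all of it, but [p] is in [U'] and not in [U]. *)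
have : disjoint_sum U V = disjoint_sum U' V.
  apply: finite_subset_card_eq.
  - apply: finite_disjoint_sum; last exact: sub_finite_set Xfin.
    by rewrite finite_setU; split; [exact: sub_finite_set Dfin|exact: finite_set1].
  - by move=> x [[y Uy <-]|]; [left; exists y => //; left|right].
  - by apply: card_eq_trans eq2; rewrite card_eq_sym.
move=> /(congr1 (fun S => S (inl p))) UU'.
have : disjoint_sum U V (inl p) by rewrite UU'; left; exists p => //; right.
by move=> [[y Uy [yp]]|[y _ //]]; apply/Up/clS; rewrite -yp.
Qed.

Definition cl_independent_family (K : Type) (L : K -> set Omega) : Prop :=
  forall k, cl (L k) `&` cl (\bigcup_(j in [set~ k]) L j) `<=` cl set0.

(** The part of [D] outside level [k] is independent from [L k], so [modular_elim] discards it. *)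
Lemma cl_independent_family_restrict (K : Type) (L D : K -> set Omega) k p :
  cl_independent_family L -> finite_set (\bigcup_j D j) ->
  (forall j, D j `<=` cl (L j)) -> cl (L k) p -> cl (\bigcup_j D j) p ->
  cl (D k) p.
Proof.
move=> Li Dfin DL Lp Dp.
apply: (@modular_elim _ (\bigcup_(j in [set~ k]) D j) (L k)) => //.
- by apply: sub_finite_set Dfin; exact: bigcup_sup.
- by apply: sub_finite_set Dfin; exact: bigcup_subset.
- apply: subset_trans (Li k) => x [Dx Lx]; split=> //.
  apply: cl_subcl Dx => y [j jk /DL]; apply: clM; exact: bigcup_sup.
- apply: clM Dp => x [j _ Dx].
  by have [<-|jk] := pselect (j = k); [left|right; exists j].
Qed.

(** [S] is independent from all old points together, so [modular_elim] removes it from whichever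
    side of the intersection it was added to; independence of the old levels then applies. *)
Lemma cl_independent_family_add (K : Type) (L : K -> set Omega) k S :
  finite_set (\bigcup_j L j) -> finite_set S ->
  cl_independent_family L -> perp cl S (\bigcup_j L j) ->
  cl_independent_family (fun j => L j `|` [set x | j = k /\ S x]).
Proof.
move=> Lfin Sfin Li SL j x [xj xnj].
have SL0 A : A `<=` cl (\bigcup_j L j) -> cl S `&` cl A `<=` cl set0.
  by move=> AL; rewrite -SL; apply: setIS; exact: cl_subcl.
have [jk|jk] := pselect (j = k).
- rewrite {j}jk in xj xnj.
  have {}xnj : cl (\bigcup_(j in [set~ k]) L j) x.
    by apply: clM xnj => y [j jk [Ly|[]//]]; exists j.
  apply: (Li k); split=> //.
  apply: (@modular_elim _ S (L k `|` \bigcup_(j in [set~ k]) L j)) => //.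
  + by apply: sub_finite_set Lfin; exact: bigcup_sup.
  + by move=> y Ly; apply: clS; left.
  + by apply: SL0 => y [Ly|[i _ Ly]]; apply: clS; [exists k|exists i].
  + by apply: clM xnj; right.
  + by apply: clM xj => y [|[_]]; [left|right].
- have {}xj : cl (L j) x by apply: clM xj => y [//|[]].
  apply: (Li j); split=> //.
  apply: (@modular_elim _ S (\bigcup_i L i)) => //.
  + by apply: sub_finite_set Lfin; exact: bigcup_subset.
  + by move=> y [i _ Ly]; apply: clS; exists i.
  + by apply: SL0; exact: clS.
  + by apply: clM xj; exact: bigcup_sup.
  + by apply: clM xnj => y [i ij [Ly|[_]]]; [left; exists i|right].
Qed.

(** A common point outside [cl set0] could be exchanged for [a], putting [a] in [cl B]. *)
Lemma notin_cl_perp a B : ~ cl B a -> perp cl [set a] B.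
Proof.
move=> Ba; apply/seteqP; split=> [x [ax Bx]|x x0]; last first.
  by split; exact: cl_set0_sub x0.
apply: contrapT => x0; apply: Ba; apply: (@cl_subcl (set0 `|` [set x])).
  by rewrite set0U => _ ->.
by apply: (cl_exchange cl_pg); rewrite set0U; split.
Qed.

Lemma infinite_dimensional_notin_cl0 :
  infinite_dimensional cl -> exists a, ~ cl set0 a.
Proof.
have [X bX] := cl_basis_exists setT cl_pg; have [_ Xi _] := bX.
move=> /(_ X bX) /infinite_setN0[a Xa].
by exists a => /(@cl_set0_sub (X `\ a) a); exact: Xi.
Qed.

End Pregeometry.

(** * Words as sequences of letters *)

Section Presented.
Context (X : Type) (R : gexpr X -> gexpr X -> Prop).

Lemma presented_gen_ind (P : presented R -> Prop) :
  P 1 -> (forall x, P (presented_gen R x)) -> (forall a, P a -> P a^-1) ->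
  (forall a b, P a -> P b -> P (a * b)) -> forall a, P a.
Proof.
move=> P1 Pgen PV PM; apply: presented_ind.
elim=> [|x|a Pa|a Pa b Pb]; [exact: P1|exact: Pgen| |].
- by rewrite -presented_class_inv; exact: PV.
- by rewrite -presented_class_mul; exact: PM.
Qed.

End Presented.

Section Words.
Context (G : groupType) (r : nat).
Local Notation letter := (G + 'I_r * bool)%type.

Definition letter_word (s : letter) : word G r :=
  match s with
  | inl c => free_prod_inl _ c
  | inr (i, true) => free_prod_inr G (free_gen i)
  | inr (i, false) => (free_prod_inr G (free_gen i))^-1
  end.

(* The head of the list is the rightmost letter of the word, the one that acts
   first. *)
Definition list_word (l : seq letter) : word G r :=
  foldr (fun s w => w * letter_word s) 1 l.

Lemma list_word_cat l l' : list_word (l ++ l') = list_word l' * list_word l.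
Proof. by elim: l => [|s l /= ->]; rewrite ?mulg1 ?mulgA. Qed.

Lemma list_word_surj (w : word G r) : exists l, w = list_word l.
Proof.
(* Carrying [w] together with its inverse turns the inversion case into a swap. *)
pose P (w : word G r) :=
  (exists l, w = list_word l) /\ exists l, w^-1 = list_word l.
suff [] : P w by [].
have P1 : P 1 by split; exists [::] => //; rewrite invg1.
have PV a : P a -> P a^-1 by move=> [Pa Pa']; split; rewrite ?invgK.
have PM a b : P a -> P b -> P (a * b).
  move=> [[la aE] [la' aE']] [[lb bE] [lb' bE']]; split.
    by exists (lb ++ la); rewrite list_word_cat -aE -bE.
  by exists (la' ++ lb'); rewrite list_word_cat -aE' -bE' invgM.
move: w; apply: presented_gen_ind => // -[c|b].
- change (P (free_prod_inl (free_group 'I_r) c)).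
  split; first by exists [:: inl c]; rewrite /= mul1g.
  by exists [:: inl c^-1]; rewrite /= mul1g -gmulfV.
(* This generator is an arbitrary element of the free group, hence a second induction. *)
- change (P (free_prod_inr G b)); move: b; apply: presented_gen_ind => [|i|b|a b].
  + by rewrite gmulf1.
  + split; first by exists [:: inr (i, true)]; rewrite /= mul1g.
    by exists [:: inr (i, false)]; rewrite /= mul1g.
  + by rewrite gmulfV; exact: PV.
  + by rewrite gmulfM; exact: PM.
Qed.

Definition letter_eval (u : 'I_r -> G) (s : letter) : G :=
  match s with
  | inl c => c
  | inr (i, true) => u i
  | inr (i, false) => (u i)^-1
  end.

Definition letter_rk (s : letter) : free_group 'I_r :=
  match s with
  | inl _ => 1
  | inr (i, true) => free_gen i
  | inr (i, false) => (free_gen i)^-1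
  end.

Lemma word_eval_nil u : word_eval (list_word [::]) u = 1.
Proof. by have [] := word_eval_morphism u. Qed.

Lemma rk_nil : rk (list_word [::]) = 1.
Proof. by have [] := rk_morphism G r. Qed.

Lemma word_eval_cons u s l :
  word_eval (list_word (s :: l)) u = word_eval (list_word l) u * letter_eval u s.
Proof.
have genE i : word_eval (free_prod_inr G (free_gen i)) u = u i.
  by rewrite -(free_lift_gen u i); exact: free_prod_liftr.
rewrite /word_eval [list_word _]/= gmulfM; congr (_ * _).
case: s => [c|[i []]] /=; first exact: free_prod_liftl.
  exact: genE.
by rewrite gmulfV; congr _^-1; exact: genE.
Qed.

Lemma rk_cons s l : rk (list_word (s :: l)) = rk (list_word l) * letter_rk s.
Proof.
rewrite /rk [list_word _]/= gmulfM; congr (_ * _).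
case: s => [c|[i []]] /=; first exact: free_prod_liftl.
  exact: free_prod_liftr.
by rewrite gmulfV; congr _^-1; exact: free_prod_liftr.
Qed.

(** Products over all subsequences of the constants of [l], later letters on the left. Keeping the
    products that skip [c] makes the set shrink along the word and always contain 1. *)
Fixpoint constant_products (l : seq letter) : set G :=
  match l with
  | [::] => [set 1]
  | inl c :: l' =>
      constant_products l' `|` [set s * c | s in constant_products l']
  | inr _ :: l' => constant_products l'
  end.

Lemma constant_products1 l : constant_products l 1.
Proof. by elim: l => [|[c|x] l IHl] //=; left. Qed.

Lemma finite_constant_products l : finite_set (constant_products l).
Proof.
elim: l => [|[c|x] l IHl] //=.
by rewrite finite_setU; split => //; exact: finite_image.
Qed.

End Words.

(** * Building the tuple along the path of a point *)

Section Trajectory.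
Context (G : groupType) (Omega : Type) (act : G -> Omega -> Omega).
Context (cl : set Omega -> set Omega).
Hypothesis actP : group_action act.
Hypothesis cl_pg : pregeometry cl.
Hypothesis cl_inv : cl_invariant act cl.
Hypothesis cl_neumann : higher_neumann act cl.
Hypothesis cl_mod : cl_modular cl.

Let clS A : A `<=` cl A.
Proof. exact: (cl_sub (pregeometry_closure cl_pg)). Qed.

Let clM A B : A `<=` B -> cl A `<=` cl B.
Proof. exact: (cl_mono (pregeometry_closure cl_pg)). Qed.

Lemma actK g : cancel (act g) (act g^-1).
Proof. by move=> x; rewrite -(actM actP) mulVg (act1 actP). Qed.

Lemma actKV g : cancel (act g^-1) (act g).
Proof. by move=> x; rewrite -(actM actP) mulgV (act1 actP). Qed.

Lemma cl_act g A x : cl A x -> cl (act g @` A) (act g x).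
Proof. by move=> Ax; rewrite cl_inv; exists x. Qed.

Lemma cl_actV g A x : cl (act g @` A) (act g x) -> cl A x.
Proof.
by rewrite cl_inv => -[y Ay /(congr1 (act g^-1))]; rewrite !actK => <-.
Qed.

(** [D k] is the level-[k] part of the domain of a partial map, and only the values of [u] there are
    binding. The level map [sigma] is abstract so that a variable and its inverse are both
    covered. *)
Lemma extend_partial_map (K : Type) (Sg : set G) (u : G) (sigma : K -> K)
    (D L : K -> set Omega) v p :
  finite_set Sg -> Sg 1 -> finite_set (\bigcup_k D k) ->
  finite_set (\bigcup_k L k) -> cl_independent_family cl L ->
  (forall k x, D k x -> cl (L k) x) ->
  (forall k x s, D k x -> Sg s -> cl (L (sigma k)) (act s (act u x))) ->
  cl (L v) p ->
  exists u' L',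
    [/\ forall k, L k `<=` L' k,
        finite_set (\bigcup_k L' k),
        cl_independent_family cl L',
        forall k x, D k x -> act u' x = act u x &
        forall s, Sg s -> cl (L' (sigma v)) (act s (act u' p))].
Proof.
move=> Sfin S1 Dfin Lfin Li DL uDL Lp.
have [Dp|Dp] := pselect (cl (\bigcup_k D k) p).
  (* Forced value: [p] depends on [D v] alone, so invariance of [cl] places its image in level
     [sigma v]. *)
  have {}Dp : cl (D v) p.
    exact: (cl_independent_family_restrict cl_pg cl_mod Li Dfin).
  exists u, L; split=> // [k //|s Ss].
  apply: (cl_subcl cl_pg _ (cl_act s (cl_act u Dp))).
  by move=> _ [_ [x Dx <-] <-]; exact: uDL.
(* Free value: [g] will fix the image of the domain, so [g * u] still extends the partial map, while
   the [Sg]-images of the new value are independent from all levels together. *)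
have uDp : ~ cl (act u @` \bigcup_k D k) (act u p) by move=> /cl_actV.
have [_ [g gD ->] gp] := cl_neumann (finite_image (act u) Dfin) Lfin
  (notin_cl_perp cl_pg uDp) Sfin.
exists (g * u).
pose S := [set act s (act g (act u p)) | s in Sg].
exists (fun j => L j `|` [set x | j = sigma v /\ S x]); split.
- by move=> k x; left.
- apply: (@sub_finite_set _ _ ((\bigcup_k L k) `|` S)).
    by move=> x [k _ [Lx|[_ Sx]]]; [left; exists k|right].
  by rewrite finite_setU; split => //; exact: finite_image.
- by apply: cl_independent_family_add => //; exact: finite_image.
- move=> k x Dx; rewrite (actM actP); apply: gD.
  by exists x => //; exists k.
- by move=> s Ss; rewrite (actM actP); apply: clS; right; split=> //; exists s.
Qed.

Context (r : nat).
Local Notation F := (free_group 'I_r).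
Local Notation letter := (G + 'I_r * bool)%type.

(* The levels are the elements of the free group together with the extra level
   None, which holds the part of the tuple that is prescribed in advance. *)
Definition level_shift (i : 'I_r) : option F -> option F :=
  omap (fun v => free_gen i * v).

Definition level_shiftV (i : 'I_r) : option F -> option F :=
  omap (fun v => (free_gen i)^-1 * v).

Lemma level_shiftK i : cancel (level_shift i) (level_shiftV i).
Proof. by case=> //= v; rewrite mulKg. Qed.

Lemma level_shiftVK i : cancel (level_shiftV i) (level_shift i).
Proof. by case=> //= v; rewrite mulVKg. Qed.

(** [D i k] is the level-[k] part of the domain on which [u i] is settled. A point and its image
    satisfy symmetric conditions, so an inverse letter can swap their roles. *)
Definition graded (Sg : set G) (u : 'I_r -> G)
    (D : 'I_r -> option F -> set Omega) (L : option F -> set Omega) : Prop :=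
  [/\ forall i, finite_set (\bigcup_k D i k),
      finite_set (\bigcup_k L k),
      cl_independent_family cl L &
      forall i k x s, D i k x -> Sg s ->
        cl (L k) (act s x) /\ cl (L (level_shift i k)) (act s (act (u i) x))].

Definition agree_on (D : 'I_r -> option F -> set Omega) (u u' : 'I_r -> G) :=
  forall i k x, D i k x -> act (u' i) x = act (u i) x.

(* Words are consumed letter by letter, so Sg shrinks to the products of the
   constants that remain to be applied. *)
Lemma graded_sub Sg Sg' u D L :
  Sg' `<=` Sg -> graded Sg u D L -> graded Sg' u D L.
Proof.
by move=> SS [Df Lf Li DL]; split=> // i k x s Dx /SS; exact: DL.
Qed.

(** Bookkeeping shared by a variable and its inverse: the value at [x0] is settled, and all earlier
    settled values survive. *)
Lemma graded_extend Sg u D L i g L' k0 x0 :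
  graded Sg u D L -> (forall k, L k `<=` L' k) ->
  finite_set (\bigcup_k L' k) -> cl_independent_family cl L' ->
  (forall k x, D i k x -> act g x = act (u i) x) ->
  (forall s, Sg s -> cl (L' k0) (act s x0)) ->
  (forall s, Sg s -> cl (L' (level_shift i k0)) (act s (act g x0))) ->
  exists u' D',
    [/\ u' i = g, D' i k0 x0, graded Sg u' D' L', agree_on D u u' &
        forall j k, D j k `<=` D' j k].
Proof.
move=> [Df Lf Li DL] LL' L'f L'i gD L'x0 L'gx0.
exists (fun j => if j == i then g else u j).
exists (fun j k => D j k `|` [set x | [/\ j = i, k = k0 & x = x0]]).
split.
- by rewrite eqxx.
- by right.
- split=> //.
    move=> j; apply: (@sub_finite_set _ _ ((\bigcup_k D j k) `|` [set x0])).
      by move=> x [k _ [Dx|[_ _ ->]]]; [left; exists k|right].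
    by rewrite finite_setU; split => //; exact: finite_set1.
  move=> j k x s [Dx|[-> -> ->]] Ss; last first.
    by rewrite eqxx; split; [exact: L'x0|exact: L'gx0].
  have [Lx Lux] := DL _ _ _ _ Dx Ss.
  split; first exact: clM Lx.
  have -> : act (if j == i then g else u j) x = act (u j) x.
    by case: eqP Dx => [->|//]; exact: gD.
  exact: clM Lux.
- by move=> j k x Dx; case: eqP Dx => [->|//]; exact: gD.
- by move=> j k x; left.
Qed.

(** The last clause holds because the value just used is recorded in [D'], so later changes of the
    tuple retrace this step. *)
Lemma letter_step Sg u D L v p (y : 'I_r * bool) :
  finite_set Sg -> Sg 1 -> graded Sg u D L ->
  (forall s, Sg s -> cl (L (Some v)) (act s p)) ->
  exists u' D' L',
    [/\ graded Sg u' D' L', agree_on D u u',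
        (forall i k, D i k `<=` D' i k) /\ (forall k, L k `<=` L' k),
        forall s, Sg s -> cl (L' (Some (letter_rk (inr y : letter) * v)))
                          (act s (act (letter_eval u' (inr y)) p)) &
        forall u'', agree_on D' u' u'' ->
          act (letter_eval u'' (inr y)) p = act (letter_eval u' (inr y)) p].
Proof.
case: y => i b Sfin S1 gr Lp; have [Df Lf Li DL] := gr.
have Lp1 : cl (L (Some v)) p by rewrite -[p](act1 actP); exact: Lp.
case: b => /=.
- have [||g [L' [LL' L'f L'i gD L'gp]]] := extend_partial_map (D := D i)
    (u := u i) (sigma := level_shift i) Sfin S1 (Df i) Lf Li _ _ Lp1.
  + by move=> k x Dx; have [] := DL _ _ _ _ Dx S1; rewrite (act1 actP).
  + by move=> k x s Dx Ss; have [] := DL _ _ _ _ Dx Ss.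
  have [|u' [D' [u'i D'p gr' uu' DD']]] :=
    graded_extend (k0 := Some v) (x0 := p) gr LL' L'f L'i gD _ L'gp.
    by move=> s Ss; apply: clM (Lp _ Ss).
  exists u', D', L'; split=> //; first by rewrite u'i.
  by move=> u'' /(_ _ _ _ D'p).
- (* The inverse letter is the same step for the inverse partial map. *)
  pose DV k := act (u i) @` D i (level_shiftV i k).
  have [|||g [L' [LL' L'f L'i gD L'gp]]] := extend_partial_map (D := DV)
    (u := (u i)^-1) (sigma := level_shiftV i) Sfin S1 _ Lf Li _ _ Lp1.
  + apply: sub_finite_set (finite_image (act (u i)) (Df i)).
    move=> _ [k _ [x Dx <-]]; exists x => //.
    by exists (level_shiftV i k).
  + move=> k _ [x Dx <-]; have [_] := DL _ _ _ _ Dx S1.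
    by rewrite level_shiftVK (act1 actP).
  + move=> k _ s [x Dx <-] Ss; rewrite actK.
    by have [] := DL _ _ _ _ Dx Ss.
  (* [g] extends the inverse partial map, so [g^-1] replaces [u i] and the point entering its domain
     is [act g p]. *)
  have [||u' [D' [u'i D'p gr' uu' DD']]] := graded_extend (i := i) (g := g^-1)
    (k0 := level_shiftV i (Some v)) (x0 := act g p) gr LL' L'f L'i _ L'gp _.
  + move=> k x Dx; apply: (can_inj (actK g)); rewrite actKV.
    rewrite (gD (level_shift i k)) ?actK//.
    by exists x => //; rewrite level_shiftK.
  + move=> s Ss; rewrite actK level_shiftVK; apply: clM (Lp _ Ss).
    exact: LL'.
  exists u', D', L'; split=> //.
  + by move=> s Ss; rewrite u'i invgK; exact: L'gp.
  + move=> u'' /(_ _ _ _ D'p); rewrite u'i invgK actK => u''p.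
    by rewrite -[in LHS]u''p actK.
Qed.

(** Induction on the letters: each step is settled once made, so the tuple found for the remaining
    letters evaluates the first one as before. *)
Lemma trajectory (l : seq letter) u D L v p :
  graded (constant_products l) u D L ->
  (forall s, constant_products l s -> cl (L (Some v)) (act s p)) ->
  exists u' L',
    [/\ cl_independent_family cl L', forall k, L k `<=` L' k,
        agree_on D u u' &
        cl (L' (Some (rk (list_word l) * v)))
           (act (word_eval (list_word l) u') p)].
Proof.
elim: l u D L v p => [|s l IHl] u D L v p gr Lp.
  have [_ _ Li _]   := gr; exists u, L; split=> // [k //|].
  rewrite rk_nil word_eval_nil mul1g; exact: Lp.
rewrite rk_cons -mulgA.
suff [u1 [D1 [L1 [gr1 [uu1 DD1 LL1] Lp1 pE]]]] : exists u1 D1 L1,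
    [/\ graded (constant_products l) u1 D1 L1,
        [/\ agree_on D u u1, forall i k, D i k `<=` D1 i k &
            forall k, L k `<=` L1 k],
        forall t, constant_products l t ->
          cl (L1 (Some (letter_rk s * v))) (act t (act (letter_eval u1 s) p)) &
        forall u', agree_on D1 u1 u' ->
          act (letter_eval u' s) p = act (letter_eval u1 s) p].
  have [u' [L' [L'i LL' u1u' L'p]]] := IHl _ _ _ _ _ gr1 Lp1.
  exists u', L'; split=> //.
  - by move=> k x /LL1; exact: LL'.
  - by move=> i k x Dx; rewrite -(uu1 _ _ _ Dx); apply/u1u'/DD1; exact: Dx.
  - by rewrite word_eval_cons (actM actP) (pE _ u1u').
case: s gr Lp => [c|y] /= gr Lp.
(* A constant changes neither tuple nor levels: the level of [p] already absorbs the products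
   [t * c]. *)
- exists u, D, L; split=> //.
  + by apply: graded_sub gr => t; left.
  + by split=> // [i k|k].
  + by move=> t lt; rewrite mul1g -(actM actP); apply: Lp; right; exists t.
- have [u1 [D1 [L1 [gr1 uu1 [DD1 LL1] Lp1 pE]]]] := letter_step y
    (finite_constant_products l) (constant_products1 l) gr Lp.
  by exists u1, D1, L1.
Qed.

Lemma regular_word_neq1_extending (w : word G r) (h : 'I_r -> G) (B : set Omega) :
  infinite_dimensional cl -> regular w -> finite_set B ->
  exists u, (forall i b, B b -> act (u i) b = act (h i) b) /\
            word_eval w u <> 1.
Proof.
move=> infdim; have [l ->] := list_word_surj w => wreg Bfin.
pose Sg := constant_products l.
(* Level [None] must absorb the prescribed points and their prescribed images, under all products of
   constants. *)
pose B' := B `|` \bigcup_(i in [set: 'I_r]) (act (h i) @` B).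
pose L0 := [set act s b | s in Sg & b in B'].
have Sfin : finite_set Sg := finite_constant_products l.
have B'fin : finite_set B'.
  rewrite finite_setU; split=> //; apply: bigcup_finite => // i _.
  exact: finite_image.
have L0fin : finite_set L0 by exact: finite_image2.
have [a0 a0N] := infinite_dimensional_notin_cl0 cl_pg infdim.
have perp0 : perp cl [set a0] set0 by exact: (notin_cl_perp cl_pg).
(* Over the empty base every translate of [a0] is allowed, so the starting point can have all its
   [Sg]-images independent from the prescribed data. *)
have [_ [g _ ->] gL0] := cl_neumann (finite_set0 Omega) L0fin perp0 Sfin.
set a := act g a0 in gL0.
have aN : ~ cl set0 a.
  by move=> a_cl; apply/a0N/(@cl_actV g); rewrite image_set0.
pose Lp (k : option F) := if k is None then L0 else set0.
pose L k := Lp k `|` [set x | k = Some 1 /\ [set act s a | s in Sg] x].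
pose D (i : 'I_r) (k : option F) := if k is None then B else set0.
have Lp0 : \bigcup_k Lp k = L0.
  by apply/seteqP; split=> [x [[v|] _]//|x L0x]; exists None.
have gr : graded Sg h D L.
  split.
  - by move=> i; apply: (sub_finite_set _ Bfin) => x [[v|] _].
  - apply: (@sub_finite_set _ _ (L0 `|` [set act s a | s in Sg])).
      by move=> x [[v|] _ [|[]]]//; [right|left].
    by rewrite finite_setU; split=> //; exact: finite_image.
  - apply: cl_independent_family_add => //; rewrite ?Lp0//.
      exact: finite_image.
    move=> [v|] x [vx nx]; first exact: vx.
    by apply: clM nx => y [[u|] nN //]; case: nN.
  - move=> i [v|] x s //= Bx Ss; split; apply: clS; left; exists s => //.
    + by exists x => //; left.
    + by exists (act (h i) x) => //; right; exists i => //; exists x.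
have La s : Sg s -> cl (L (Some 1)) (act s a).
  by move=> Ss; apply: clS; right; split=> //; exists s.
have [u [L' [L'i LL' hu]]] := trajectory gr La.
rewrite mulg1 => L'w; exists u; split.
  by move=> i b Bb; exact: (hu i None).
(* If the path closed up, [a] would lie in the closures of two distinct levels, that of 1 and that
   of the rank. *)
move=> w1; apply: aN; apply: (L'i (Some 1)); split.
  apply: clM (LL' (Some 1)) _ _; rewrite -[a](act1 actP); apply: La.
  exact: constant_products1.
move: L'w; rewrite w1 (act1 actP); apply: clM; apply: bigcup_sup => -[].
exact: wreg.
Qed.
End Trajectory.

(** * Neighbourhoods for pointwise convergence, and density *)

Lemma nbhs_pointwise (G : groupType) (Omega : Type) (act : G -> Omega -> Omega)
    (h : pointwise act) (A : set (pointwise act)) :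
  nbhs h A ->
  exists2 B : set Omega, finite_set B &
    forall g : G, (forall b, B b -> act g b = act h b) -> A g.
Proof.
rewrite nbhsE => -[U [[S SB <-] [V SV Vh]] UA].
have [n [b [b' VE]]] := SB _ SV.
exists [set x | x \in (tval b : seq {classic Omega})];
  first exact: (@finite_seq {classic Omega}).
move=> g gh; apply: UA; exists V => //; move: Vh; rewrite VE /= => <-.
by apply/(@eq_in_map {classic Omega}) => x xb; exact: gh.
Qed.

(** The sets containing [agree B] for some finite [B] form a filter, whose convergence to [h] in the
    product topology is tested coordinatewise. *)
Lemma nbhs_ptws_pointwise (G : groupType) (Omega : Type)
    (act : G -> Omega -> Omega) (I : finType) (h : {ptws I -> pointwise act})
    (A : set {ptws I -> pointwise act}) :
  nbhs h A ->
  exists2 B : set Omega, finite_set B &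
    forall u : I -> G, (forall i b, B b -> act (u i) b = act (h i) b) -> A u.
Proof.
pose agree B := [set u : {ptws I -> pointwise act} |
  forall i b, B b -> act (u i) b = act (h i) b].
pose Fl : set_system {ptws I -> pointwise act} :=
  [set A | exists2 B, finite_set B & agree B `<=` A].
have FlF : Filter Fl.
  split.
  - by exists set0.
  - move=> P Q [B Bf BP] [C Cf CQ]; exists (B `|` C).
      by rewrite finite_setU.
    move=> u BCu; split; [apply: BP|apply: CQ] => i b Bb; apply: BCu;
      by [left|right].
  - by move=> P Q PQ [B Bf BP]; exists B => //; exact: subset_trans PQ.
suff : Fl --> h by move=> /(_ A) Fh /Fh[B Bf BA]; exists B.
apply/cvg_sup => i P /= [_ [[V oV <-] Vh] VP].
have [B Bf BV] : exists2 B : set Omega, finite_set B &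
    forall g : G, (forall b, B b -> act g b = act (h i) b) -> V g.
  by apply: nbhs_pointwise; exact: open_nbhs_nbhs.
by exists B => // u Bu; apply/VP/BV => b; exact: Bu.
Qed.

Unset Implicit Arguments.

Theorem theorem3p8 (G : groupType) (Omega : Type) (act : G -> Omega -> Omega)
  (cl : set Omega -> set Omega)
  (act_action : group_action act) (act_faithful : faithful act)
  (Omega_infinite : infinite_set [set: Omega])
  (cl_pregeometry : pregeometry cl)
  (cl_inv : cl_invariant act cl)
  (cl_infdim : infinite_dimensional cl)
  (cl_neumann : higher_neumann act cl)
  (cl_mod : cl_modular cl) :
  (forall (r : nat) (w : word G r), (1 <= r)%N -> regular w ->
     dense [set g : {ptws 'I_r -> pointwise act} | word_eval w g <> 1]) /\
  (forall (r : nat) (w : word G r), mixed_identity w -> singular w).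
Proof.
have regular_tuple r (w : word G r) h B := @regular_word_neq1_extending _ _ _ _
  act_action cl_pregeometry cl_inv cl_neumann cl_mod r w h B cl_infdim.
split=> [r w _ w_reg O [h Oh] Oopen | r w w_id].
  have [|B Bfin BO] := @nbhs_ptws_pointwise _ _ act _ h O.
    exact: open_nbhs_nbhs.
  have [u [uh wu]] := regular_tuple r w h B w_reg Bfin.
  by exists u; split=> //; exact: BO.
(* Even with nothing prescribed, a regular word takes a nontrivial value. *)
apply: contrapT => w_reg.
have [u [_]] := regular_tuple r w (fun=> 1) set0 w_reg (finite_set0 Omega).
by apply; exact: w_id.
Qed.
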